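(* Let $S$ be a cyclotomic numerical semigroup with semigroup polynomial $\mathrm{P}_S$. (1) If $\mathrm{P}_S$ is irreducible, then there are distinct primes $p \neq q$ such that $S=\langle p,q\rangle$ and $\mathrm{P}_S = \Phi_{pq}$. (2) If $\mathrm{P}_S$ is a product of two irreducible polynomials, then either (a) there are distinct primes $p,q$ such that $S=\langle p,q^2\rangle$ and $\mathrm{P}_S= \Phi_{pq}\Phi_{pq^2}$; or (b) there are distinct primes $p,q,r$ with $p \in \langle q, r \rangle$ such that $S=\langle p, q^2,qr\rangle$ and $\mathrm{P}_S= \Phi_{pq} \Phi_{q^2r}$.
   Context: $\mathbb{N}$ denotes the non-negative integers. A numerical semigroup $S$ is an additive submonoid of $\mathbb{N}$ (so $0\in S$) with finite complement in $\mathbb{N}$; $\langle n_1,\dots,n_e\rangle$ denotes the additive submonoid of $\mathbb{N}$ generated by $n_1,\dots,n_e$. The semigroup polynomial of $S$ is $\mathrm{P}_S(x) = 1 + (x-1) \sum_{g \in \mathbb{N} \setminus S} x^g = (1-x)\sum_{s\in S}x^s$. $\Phi_n$ denotes the $n$-th cyclotomic polynomial. $S$ is cyclotomic if $\mathrm{P}_S$ is a (possibly empty) product of cyclotomic polynomials, with repetitions allowed. Irreducibility is over the rationals; the two irreducible polynomials in part (2) are not assumed distinct. *)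

(* Defs.v *)
From mathcomp Require Import all_boot all_order all_algebra all_field.
From mathcomp Require Import all_classical.

Set Implicit Arguments.
Unset Strict Implicit.
Unset Printing Implicit Defensive.

Import GRing.Theory.

Local Open Scope classical_set_scope.
Local Open Scope ring_scope.

Definition submonoid (M : set nat) : Prop :=
  M 0%N /\ (forall m n : nat, M m -> M n -> M (m + n)%N).

Definition generated_submonoid (G : set nat) : set nat := smallest submonoid G.

Definition numerical_semigroup (S : set nat) : Prop :=
  submonoid S /\ finite_set (~` S).

(* The sum is fsbigop's sum over a classical set, whose value is 0 when
   infinitely many terms are nonzero; so this is the semigroup polynomial
   only when ~` S is finite. *)
Definition semigroup_poly (S : set nat) : {poly int} :=
  1 + ('X - 1) * \sum_(g \in ~` S) ('X^g : {poly int}).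

(* Repetitions in s are allowed, and s may be empty. The library sets
   'Phi_0 = 'Phi_1, hence the explicit restriction to positive indices. *)
Definition cyclotomic_semigroup (S : set nat) : Prop :=
  numerical_semigroup S /\
  exists2 s : seq nat, all (fun n => 0 < n)%N s &
    semigroup_poly S = \prod_(n <- s) 'Phi_n.

Definition poly_int_to_rat (P : {poly int}) : {poly rat} :=
  map_poly (intr : int -> rat) P.

(* Main.v *)
(** With [h] the indicator function of [S] and [s] the list of indices of the cyclotomic
factors, Newton's identities for [P_S / (1 - x)] read
[n h(n) = - sum_(0 < k <= n) c(k) h(n - k)], where [c(k) + 1] is the sum over [m] in [s] of the
Ramanujan sums [ram m k] (the [k]-th power sums of the primitive [m]-th roots of unity).
Hence [c] vanishes off [S], and conversely a submonoid off which [c] vanishes contains [S].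

Since [1] is a gap, the values [ram m 1] (the Moebius function of [m]) add up to [1]: a single
factor has an index with an even number of prime factors, all simple; of two factors one index,
[a], is of this kind and the other, [b], is not squarefree.  The identities at a prime [p]
dividing [a] show that [p] is in [S] unless [p^2] exactly divides [b], which happens for at most
one [p].  Two coprime elements [u], [v] of [S] bound its Frobenius number by [uv - u - v], while
that number is the degree of [P_S] minus one; comparing the two leaves only the listed indices. *)

Require Import Defs.
From mathcomp Require Import all_boot all_order all_algebra all_field.
From mathcomp Require Import all_classical.
From mathcomp Require Import ring zify.

Import Order.TTheory GRing.Theory Num.Theory.

Local Open Scope classical_set_scope.
Local Open Scope ring_scope.

Lemma uniq_sub_perm (T : eqType) (s1 s2 : seq T) : uniq s1 -> uniq s2 ->
  {subset s1 <= s2} -> (size s2 <= size s1)%N -> perm_eq s1 s2.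
Proof.
by move=> u1 u2 sub le; apply: uniq_perm => //; case: (uniq_min_size u1 sub le).
Qed.

(** ** Power sums of primitive roots of unity *)

(** [C_prim_root_exists] asks for a positive order, here [m.-1.+1]; this is [m] only when [m] is
    positive. *)
Definition prim_root (m : nat) : algC := sval (C_prim_root_exists (ltn0Sn m.-1)).

Lemma prim_rootE m : (0 < m)%N -> m.-primitive_root (prim_root m).
Proof. by case: m => // m _; rewrite /prim_root; case: C_prim_root_exists. Qed.

Definition prim_roots (m : nat) : seq algC :=
  [seq prim_root m ^+ i | i <- iota 0 m & coprime i m].

Definition unity_roots (m : nat) : seq algC :=
  [seq prim_root m ^+ i | i <- iota 0 m].

Lemma unity_roots_uniq m : uniq (unity_roots m).
Proof.
have [->//|m0] := posnP m.
rewrite /unity_roots map_inj_in_uniq; first exact: iota_uniq.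
move=> i j; rewrite !mem_iota !add0n => im jm /eqP.
by rewrite (eq_prim_root_expr (prim_rootE m m0)) !modn_small // => /eqP.
Qed.

Lemma prim_roots_uniq m : uniq (prim_roots m).
Proof.
have: subseq (prim_roots m) (unity_roots m) by apply: map_subseq; apply: filter_subseq.
by move/subseq_uniq; apply; apply: unity_roots_uniq.
Qed.

Lemma mem_unity_roots m x : (0 < m)%N -> (x \in unity_roots m) = (x ^+ m == 1).
Proof.
move=> m0; have zP := prim_rootE m m0.
apply/mapP/eqP => [[i _ ->]|/(prim_rootP zP)[i ->]].
  by rewrite exprAC (prim_expr_order zP) expr1n.
by exists (i : nat) => //; rewrite mem_iota /= add0n.
Qed.

Lemma mem_prim_roots m x : (0 < m)%N -> (x \in prim_roots m) = m.-primitive_root x.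
Proof.
move=> m0; have zP := prim_rootE m m0.
apply/mapP/idP => [[i]|xP].
  by rewrite mem_filter => /andP[ci _] ->; rewrite prim_root_exp_coprime.
have /(prim_rootP zP)[i xE] := prim_expr_order xP.
exists (i : nat) => //; rewrite mem_filter mem_iota add0n ltn_ord andbT /= andbT.
by rewrite -(prim_root_exp_coprime i zP) -xE.
Qed.

Lemma size_prim_roots m : size (prim_roots m) = totient m.
Proof.
rewrite /prim_roots size_map size_filter totient_count_coprime.
rewrite -sum1_count big_mkcond /= /index_iota subn0.
by apply: eq_bigr => i _; rewrite coprime_sym; case: coprime.
Qed.

Lemma Cyclotomic_prod_prim_roots m : (0 < m)%N ->
  map_poly (intr : int -> algC) 'Phi_m = \prod_(x <- prim_roots m) ('X - x%:P).
Proof.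
move=> m0; rewrite (Cintr_Cyclotomic (prim_rootE m m0)) /cyclotomic big_map big_filter.
rewrite -(big_mkord (fun k => coprime k m) (fun k => 'X - (prim_root m ^+ k)%:P)).
by rewrite /index_iota subn0.
Qed.

Definition ramC m k : algC := \sum_(x <- prim_roots m) x ^+ k.

(** A Bezout coefficient [u], inverse to [j] modulo [m], recovers an [m]-th root of unity [x] as the
    [u]-th power of [x ^+ j]. *)
Lemma coprime_expr_inj (m j : nat) (x y : algC) : coprime j m ->
  x ^+ m = 1 -> y ^+ m = 1 -> x ^+ j = y ^+ j -> x = y.
Proof.
move=> cjm xm ym xyj.
have [j0'|j0] := posnP j.
  move: cjm; rewrite j0' /coprime gcd0n => /eqP m1.
  by move: xm ym; rewrite m1 !expr1 => -> ->.
have [u v uv _] := egcdnP m j0.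
have xE z : z ^+ m = 1 -> z = (z ^+ j) ^+ u :> algC.
  move=> zm; rewrite -exprM mulnC uv (eqP cjm) exprD mulnC exprM zm.
  by rewrite expr1n mul1r.
by rewrite (xE x) // (xE y) // xyj.
Qed.

(** Raising to the power [j] permutes the primitive [m]-th roots of unity. *)
Lemma ramC_mul_coprime m j k : (0 < m)%N -> coprime j m -> ramC m (j * k) = ramC m k.
Proof.
move=> m0 cjm; rewrite /ramC.
have -> : \sum_(x <- prim_roots m) x ^+ (j * k) =
          \sum_(x <- [seq x ^+ j | x <- prim_roots m]) x ^+ k.
  by rewrite [RHS]big_map; apply: eq_bigr => x _; rewrite exprM.
apply: perm_big; apply: uniq_sub_perm; rewrite ?prim_roots_uniq ?size_map //.
- rewrite map_inj_in_uniq ?prim_roots_uniq // => x y; rewrite !mem_prim_roots //.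
  by move=> /prim_expr_order xm /prim_expr_order ym; apply: (@coprime_expr_inj m).
- move=> _ /mapP[x xP ->]; move: xP; rewrite !mem_prim_roots // => xP.
  by rewrite prim_root_exp_coprime.
Qed.

(** If [d] is the order of [x y], the [n]-th power of [(x y)^d = 1] removes [y] and gives [m | d n],
    hence [m | d]; symmetrically [n | d]. *)
Lemma prim_root_mul m n (x y : algC) : coprime m n ->
  m.-primitive_root x -> n.-primitive_root y -> (m * n).-primitive_root (x * y).
Proof.
move=> cmn xP yP.
have m0 := prim_order_gt0 xP; have n0 := prim_order_gt0 yP.
have xyE : (x * y) ^+ (m * n) = 1.
  rewrite exprMn exprM (prim_expr_order xP) expr1n.
  by rewrite mulnC exprM (prim_expr_order yP) expr1n mulr1.
have mn0 : (0 < m * n)%N by rewrite muln_gt0 m0.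
have [d dP dmn] := prim_order_exists mn0 xyE.
suff /eqP <- : d == (m * n)%N by [].
rewrite eqn_dvd dmn /= Gauss_dvd //; have xyd := prim_expr_order dP.
apply/andP; split.
- rewrite -(Gauss_dvdr _ cmn) (prim_order_dvd xP).
  have := congr1 (fun z => z ^+ n) xyd.
  rewrite expr1n -exprM exprMn (mulnC d n) (exprM y).
  by rewrite (prim_expr_order yP) expr1n mulr1 => ->.
- have cnm : coprime n m by rewrite coprime_sym.
  rewrite -(Gauss_dvdr _ cnm) (prim_order_dvd yP).
  have := congr1 (fun z => z ^+ m) xyd.
  rewrite expr1n -exprM exprMn (mulnC d m) (exprM x).
  by rewrite (prim_expr_order xP) expr1n mul1r => ->.
Qed.

(** The products [x y] run once through the primitive [m n]-th roots: the [n]-th power separates the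
    [x], the [m]-th power the [y], and the count is the multiplicativity of the totient. *)
Lemma ramC_coprime m n k : (0 < m)%N -> (0 < n)%N -> coprime m n ->
  ramC (m * n) k = ramC m k * ramC n k.
Proof.
move=> m0 n0 cmn.
have mn0 : (0 < m * n)%N by rewrite muln_gt0 m0.
have cnm : coprime n m by rewrite coprime_sym.
transitivity (\sum_(z <- [seq x * y | x <- prim_roots m, y <- prim_roots n]) z ^+ k).
  rewrite /ramC; apply: perm_big; rewrite perm_sym; apply: uniq_sub_perm.
  - apply: allpairs_uniq; rewrite ?prim_roots_uniq // => -[x y] [x' y'].
    move=> /allpairsP[[a b] [/= + + [-> ->]]] /allpairsP[[a' b'] [/= + + [-> ->]]].
    rewrite !mem_prim_roots // => /prim_expr_order am /prim_expr_order bn.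
    move=> /prim_expr_order am' /prim_expr_order bn' E; congr (_, _).
    + apply: (coprime_expr_inj m n) => //.
      by have := congr1 (fun z => z ^+ n) E; rewrite !exprMn bn bn' !mulr1.
    + apply: (coprime_expr_inj n m) => //.
      by have := congr1 (fun z => z ^+ m) E; rewrite !exprMn am am' !mul1r.
  - exact: prim_roots_uniq.
  - move=> _ /allpairsP[[a b] [/= + + ->]].
    by rewrite !mem_prim_roots // => *; apply: prim_root_mul.
  - by rewrite size_allpairs !size_prim_roots totient_coprime.
rewrite big_allpairs_dep /ramC big_distrl /=; apply: eq_bigr => x _.
by rewrite big_distrr /=; apply: eq_bigr => y _; rewrite exprMn.
Qed.

Lemma sum_unity_roots m k : (0 < m)%N ->
  \sum_(x <- unity_roots m) x ^+ k = (m * (m %| k))%:R.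
Proof.
move=> m0; have zP := prim_rootE m m0.
have -> : \sum_(x <- unity_roots m) x ^+ k = \sum_(i < m) (prim_root m ^+ k) ^+ i.
  rewrite big_map -(big_mkord xpredT (fun i => (prim_root m ^+ k) ^+ i)).
  by rewrite /index_iota subn0; apply: eq_bigr => i _; rewrite exprAC.
case: (boolP (m %| k)%N) => [|ndvd].
  rewrite (prim_order_dvd zP) => /eqP ->; rewrite muln1.
  under eq_bigr do rewrite expr1n.
  by rewrite sumr_const card_ord.
rewrite muln0; apply/eqP; move: ndvd; rewrite (prim_order_dvd zP) -subr_eq0.
move=> /mulfI /inj_eq <-; rewrite mulr0 -subrX1 exprAC (prim_expr_order zP).
by rewrite expr1n subrr.
Qed.

(** The [p^(e+1)]-th roots of unity are the primitive ones together with the [p^e]-th ones. *)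
Lemma ramC_prime_power p e k : prime p ->
  ramC (p ^ e.+1) k = (p ^ e.+1 * (p ^ e.+1 %| k))%:R - (p ^ e * (p ^ e %| k))%:R.
Proof.
move=> pp; have pe0 i : (0 < p ^ i)%N by rewrite expn_gt0 prime_gt0.
rewrite -!sum_unity_roots //; apply/eqP; rewrite eq_sym subr_eq eq_sym; apply/eqP.
rewrite /ramC -big_cat; apply: perm_big; apply: uniq_perm.
- rewrite cat_uniq prim_roots_uniq unity_roots_uniq andbT /=.
  apply/hasPn => x; rewrite mem_prim_roots // mem_unity_roots // => xe.
  apply/negP => xP; move: xe; rewrite -(prim_order_dvd xP).
  by rewrite dvdn_Pexp2l ?prime_gt1 // ltnn.
- exact: unity_roots_uniq.
move=> x; rewrite mem_cat mem_prim_roots // !mem_unity_roots //; apply/idP/idP.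
  case/orP => [/prim_expr_order ->//|/eqP xe].
  by rewrite expnSr exprM xe expr1n.
move=> /eqP xe; have [d dP] := prim_order_exists (pe0 e.+1) xe.
case/(dvdn_pfactor _ _ pp) => i; rewrite leq_eqVlt => /orP[/eqP -> <-|].
  by rewrite dP.
rewrite ltnS => ie dE; apply/orP; right; rewrite -(prim_order_dvd dP) dE.
by rewrite dvdn_exp2l.
Qed.

Lemma ramC1 k : ramC 1 k = 1.
Proof.
by rewrite /ramC /prim_roots /= big_seq1 expr0 expr1n.
Qed.

(** Each step splits off the full power of one prime, as suits functions that are multiplicative on
    coprime arguments. *)
Lemma prime_power_ind (P : nat -> Prop) : P 1%N ->
  (forall p e m, prime p -> (0 < m)%N -> coprime p m -> P m -> P (p ^ e.+1 * m)%N) ->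
  forall m, (0 < m)%N -> P m.
Proof.
move=> P1 Pm m; have [n] := ubnP m; elim: n m => // n IH m mn m0.
have [m1|/pdivP[p pp pm]] := leqP m 1; first by have -> : m = 1%N by lia.
have [m' cpm mE] := pfactor_coprime pp m0.
have l0 : (0 < logn p m)%N by rewrite logn_gt0 mem_primes pp m0.
have [e eE] : exists e, logn p m = e.+1 by exists (logn p m).-1; rewrite prednK.
have m'0 : (0 < m')%N by case: (m') mE => // mE; rewrite mE in m0.
rewrite mE eE mulnC; apply: Pm => //; apply: IH => //.
rewrite ltnS in mn; apply: leq_trans mn; rewrite mE eE expnS.
have := prime_gt1 pp; have : (0 < p ^ e)%N by rewrite expn_gt0 prime_gt0.
by move=> pe0 p1; apply: ltn_Pmulr => //; nia.
Qed.

Lemma ramC_int m k : (0 < m)%N -> ramC m k \is a Num.int.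
Proof.
move: m; apply: prime_power_ind => [|p e m pp m0 cpm IH]; first by rewrite ramC1.
rewrite ramC_coprime ?expn_gt0 ?(prime_gt0 pp) ?coprimeXl //. apply: rpredM => //.
by rewrite ramC_prime_power //; apply: rpredB; apply: rpred_nat.
Qed.

(** The Ramanujan sum as an integer; for positive [m] the floor loses nothing, by [ramC_int]. *)
Definition ram m k : int := Num.floor (ramC m k).

Lemma ramE m k : (0 < m)%N -> (ram m k)%:~R = ramC m k.
Proof. by move=> m0; apply/eqP; rewrite -intrEfloor; apply: ramC_int. Qed.

Lemma ram1 k : ram 1 k = 1.
Proof. by rewrite /ram ramC1 floor1. Qed.

Lemma ram_coprime m n k : (0 < m)%N -> (0 < n)%N -> coprime m n ->
  ram (m * n) k = ram m k * ram n k.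
Proof.
move=> m0 n0 cmn; apply: (@intr_inj algC); rewrite rmorphM /= !ramE ?muln_gt0 ?m0 //.
exact: ramC_coprime.
Qed.

Lemma ram_prime_power p e k : prime p -> ram (p ^ e.+1) k =
  (p ^ e.+1 * (p ^ e.+1 %| k))%N%:Z - (p ^ e * (p ^ e %| k))%N%:Z.
Proof.
move=> pp; apply: (@intr_inj algC); rewrite ramE ?expn_gt0 ?prime_gt0 //.
by rewrite ramC_prime_power // rmorphB.
Qed.

Lemma ram_prime p k : prime p -> ram p k = (p * (p %| k))%N%:Z - 1.
Proof. by move=> pp; have := ram_prime_power p 0 k pp; rewrite expn1 expn0 dvd1n. Qed.

Lemma ram_mul_coprime m j k : (0 < m)%N -> coprime j m -> ram m (j * k) = ram m k.
Proof. by move=> m0 cjm; rewrite /ram ramC_mul_coprime. Qed.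

(** * Ramanujan sums at 1, at primes and at integers prime to the index *)

Lemma ram_at_coprime m j : (0 < m)%N -> coprime j m -> ram m j = ram m 1.
Proof. by move=> m0 cjm; rewrite -{1}(muln1 j) ram_mul_coprime. Qed.

Lemma prime_power_dvdn1 p e : prime p -> (p ^ e %| 1)%N = (e == 0)%N.
Proof.
move=> /prime_gt1 p1; case: e => [|e]; rewrite ?expn0 // dvdn1 expnS muln_eq1.
by rewrite (gtn_eqF p1).
Qed.

(** The value at 1 is the Moebius function: a simple prime factor contributes -1, a repeated one
    0. *)
Lemma ram_at1_range m : (0 < m)%N -> [\/ ram m 1 = -1, ram m 1 = 0 | ram m 1 = 1].
Proof.
move: m; apply: prime_power_ind => [|p e m pp m0 cpm IH].
  by rewrite ram1; constructor 3.
rewrite ram_coprime ?expn_gt0 ?(prime_gt0 pp) ?coprimeXl // ram_prime_power //.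
rewrite !prime_power_dvdn1 // muln0 sub0r.
case: e => [|e] /=; last by rewrite muln0 oppr0 mul0r; constructor 2.
by rewrite mulN1r; case: IH => ->; [constructor 3|constructor 2|constructor 1].
Qed.

(** A nonzero Moebius value allows [p] only to the first power, and removing it changes the sign. *)
Lemma ram_squarefree m p : (0 < m)%N -> prime p -> (p %| m)%N -> ram m 1 != 0 ->
  exists m', [/\ m = (p * m')%N, coprime p m', (0 < m')%N & ram m' 1 = - ram m 1].
Proof.
move=> m0 pp pm r0; have [m' cpm mE] := pfactor_coprime pp m0.
have m'0 : (0 < m')%N by case: (m') mE => // mE; rewrite mE in m0.
have l0 : (0 < logn p m)%N by rewrite logn_gt0 mem_primes pp m0.
have p1 := prime_gt1 pp.
have [e eE] : exists e, logn p m = e.+1 by exists (logn p m).-1; rewrite prednK.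
have rE : ram m 1 = ram (p ^ e.+1) 1 * ram m' 1.
  by rewrite mE eE mulnC ram_coprime ?expn_gt0 ?(prime_gt0 pp) ?coprimeXl.
rewrite ram_prime_power // !prime_power_dvdn1 // in rE.
case: e => [|e] in eE rE *; last by rewrite rE /= !muln0 subrr mul0r eqxx in r0.
exists m'; split => //; first by rewrite mE eE mulnC expn1.
by rewrite rE /= expn0 muln1 muln0 sub0r mulN1r opprK.
Qed.

(** Let [p^l] exactly divide [m]. For [l = 0] the values at [p] and at 1 agree, for [l = 1] both
    vanish together with [ram m' 1], and for [l > 2] the value at [p] is 0. So [l = 2], where that
    value is [- p] times [ram m' 1]. *)
Lemma ram_ramified m p : (0 < m)%N -> prime p -> ram m 1 = 0 -> ram m p = p%:Z ->
  exists m', [/\ m = (p ^ 2 * m')%N, coprime p m', (0 < m')%N & ram m' 1 = -1].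
Proof.
move=> m0 pp r0 rp; have [m' cpm mE] := pfactor_coprime pp m0.
have m'0 : (0 < m')%N by case: (m') mE => // mE; rewrite mE in m0.
have p1 := prime_gt1 pp.
case eE : (logn p m) => [|e].
  move: rp; rewrite ram_at_coprime ?r0; first by lia.
  by [].
  by rewrite mE eE muln1.
have cpe : coprime (p ^ e.+1) m' by rewrite coprimeXl.
have pe0 : (0 < p ^ e.+1)%N by rewrite expn_gt0 prime_gt0.
have rE k : ram m k = ram (p ^ e.+1) k * ram m' k.
  by rewrite mE eE mulnC ram_coprime.
move: rp r0; rewrite !rE (ram_at_coprime m' p) //.
rewrite !ram_prime_power // !prime_power_dvdn1 //.
case: e eE {cpe pe0 rE} => [|[|e]] eE.
- rewrite expn1 dvdnn muln0 muln1 expn0 sub0r mulN1r => rp r0.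
  by move: rp; rewrite -[ram m' 1]opprK r0 oppr0 mulr0; lia.
- rewrite expn1 dvdnn (_ : (p ^ 2 %| p) = false)%N; last first.
    by apply/negP => /dvdn_leq -/(_ (prime_gt0 pp)); nia.
  rewrite muln0 muln1 sub0r => rp _; exists m'; split => //; first by rewrite mE eE mulnC.
  have p0 : p%:Z != 0 by lia.
  by apply: (mulfI p0); rewrite mulrN1 -[RHS]opprK opprK -[in RHS]rp mulNr opprK.
- have N i : (p ^ i.+2 %| p)%N = false.
    rewrite -{2}(expn1 p) dvdn_Pexp2l //.
  by rewrite !N; lia.
Qed.

(** ** Newton's identities *)

Definition newton_series (N : nat) (c : nat -> algC) : {poly algC} :=
  \sum_(1 <= k < N) c k *: 'X^k.

(* [P] divides [- x P'] with quotient [sum c(k) x^k], modulo [x^N]: the coefficients [c(k)] of the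
   logarithmic derivative are the power sums of the inverse roots of [P]. *)
Definition newton (N : nat) (P : {poly algC}) (c : nat -> algC) : bool :=
  'X^N %| 'X * P^`() + P * newton_series N c.

Lemma newton1 N : newton N 1 (fun=> 0).
Proof.
rewrite /newton /newton_series derivC mulr0 add0r mul1r big1 ?dvdp0 // => i _.
by rewrite scale0r.
Qed.

(** Logarithmic derivatives add under multiplication. *)
Lemma newtonM N P Q c d : newton N P c -> newton N Q d ->
  newton N (P * Q) (fun k => c k + d k).
Proof.
rewrite /newton => cP dQ.
have -> : newton_series N (fun k => c k + d k) = newton_series N c + newton_series N d.
  by rewrite /newton_series -big_split; apply: eq_bigr => i _; rewrite scalerDl.
have -> : 'X * (P * Q)^`() + P * Q * (newton_series N c + newton_series N d) =
  Q * ('X * P^`() + P * newton_series N c) + P * ('X * Q^`() + Q * newton_series N d).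
  by rewrite derivM; ring.
by rewrite dvdp_add // dvdp_mull.
Qed.

Lemma newton_prod N (I : eqType) (r : seq I) (F : I -> {poly algC}) (c : I -> nat -> algC) :
  (forall i, i \in r -> newton N (F i) (c i)) ->
  newton N (\prod_(i <- r) F i) (fun k => \sum_(i <- r) c i k).
Proof.
elim: r => [|i r IH] H.
  rewrite big_nil; suff -> : (fun k => \sum_(i <- [::]) c i k) = (fun=> 0) by apply: newton1.
  by apply/funext => k; rewrite big_nil.
rewrite big_cons.
have -> : (fun k => \sum_(i <- i :: r) c i k) = (fun k => c i k + \sum_(i <- r) c i k).
  by apply/funext => k; rewrite big_cons.
apply: newtonM; first by apply: H; rewrite mem_head.
by apply: IH => j jr; apply: H; rewrite inE jr orbT.
Qed.

Lemma newton_XsubC N (x : algC) : x != 0 -> newton N ('X - x%:P) (fun k => x^-1 ^+ k).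
Proof.
move=> x0; case: N => [|N]; first by rewrite /newton expr0 dvd1p.
rewrite /newton; set Q := (Q in _ %| Q).
(* The geometric sum telescopes against ['X - x] and leaves one monomial of degree [N.+1]. *)
suff -> : Q = (x^-1 ^+ N) *: 'X^(N.+1) by rewrite dvdpZr // expf_neq0 // invr_eq0.
rewrite {}/Q derivXsubC mulr1 /newton_series.
elim: N => [|N IH].
  by rewrite big_geq // mulr0 addr0 expr0 scale1r expr1.
rewrite big_nat_recr //= mulrDr addrA IH mulrBl -!scalerAr.
have cx : x^-1 ^+ N.+1 * x = x^-1 ^+ N by rewrite exprSr mulfVK.
by rewrite mul_polyC scalerA cx -exprS addrC subrK.
Qed.

(** On [m]-th roots of unity inversion is the power [m - 1], and [m - 1] is prime to [m]. *)
Lemma ramC_inv m k : (0 < m)%N -> \sum_(x <- prim_roots m) x^-1 ^+ k = ramC m k.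
Proof.
move=> m0; rewrite -(ramC_mul_coprime m m.-1 k) //; last first.
  by rewrite coprime_sym coprimenP.
rewrite /ramC big_seq [RHS]big_seq; apply: eq_bigr => x.
rewrite mem_prim_roots // => /prim_expr_order xm; rewrite exprM; congr (_ ^+ _).
have xU : x * x ^+ m.-1 = 1 by rewrite -exprS prednK.
have x0 : x != 0 by apply: contra_eq_neq xU => ->; rewrite mul0r eq_sym oner_eq0.
by apply: (mulfI x0); rewrite xU mulfV.
Qed.

Lemma newton_Cyclotomic N m : (0 < m)%N ->
  newton N (map_poly (intr : int -> algC) 'Phi_m) (fun k => (ram m k)%:~R).
Proof.
move=> m0; rewrite Cyclotomic_prod_prim_roots //.
have -> : (fun k => (ram m k)%:~R) = (fun k => \sum_(x <- prim_roots m) x^-1 ^+ k).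
  by apply/funext => k; rewrite ramC_inv // ramE.
apply: newton_prod => x; rewrite mem_prim_roots // => xP; apply: newton_XsubC.
by rewrite (prim_root_eq0 xP) -lt0n.
Qed.

(** Dividing by [1 - x] lowers every power sum by 1, the contribution of the root 1. The first
    hypothesis makes [H] agree with the series [P / (1 - x)] modulo ['X^N]. *)
Lemma newton_geometric_quotient N (H P : {poly algC}) c :
  (1 - 'X) * H = P - 'X^N -> newton N P c -> newton N H (fun k => c k - 1).
Proof.
move=> HP; rewrite /newton => cP.
have -> : newton_series N (fun k => c k - 1) = newton_series N c - newton_series N (fun=> 1).
  by rewrite /newton_series -sumrB; apply: eq_bigr => i _; rewrite scalerBl.
case: N => [|N] in HP cP *; first by rewrite expr0 dvd1p.
have EE : (1 - 'X) * newton_series N.+1 (fun=> 1) = 'X - 'X^(N.+1) :> {poly algC}.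
  rewrite /newton_series; under eq_bigr do rewrite scale1r.
  elim: N {HP cP} => [|N IH]; first by rewrite big_geq // mulr0 expr1 subrr.
  by rewrite big_nat_recr //= mulrDr IH (exprS _ N.+1); ring.
have HP' : (1 - 'X) * H^`() = P^`() - 'X^N *+ N.+1 + H.
  have := congr1 (@deriv _) HP; rewrite derivM !derivB derivX derivXn derivC /=.
  by move=> <-; ring.
(* As [1 - 'X] is prime to ['X^(N.+1)], divisibility may be tested after multiplying by it. *)
have cop : coprimep ('X^(N.+1)) (1 - 'X : {poly algC}).
  by apply: coprimep_expl; rewrite coprimep_sym coprimepX rootE !hornerE ?subr0 ?oner_eq0.
rewrite -(Gauss_dvdpr _ cop).
set C := newton_series _ c in cP *; set E := newton_series _ _ in EE *.
have -> : (1 - 'X) * ('X * H^`() + H * (C - E)) =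
  'X * ((1 - 'X) * H^`()) + ((1 - 'X) * H) * C - H * ((1 - 'X) * E) by ring.
rewrite HP' HP EE.
have -> : 'X * (P^`() - 'X^N *+ N.+1 + H) + (P - 'X^(N.+1)) * C - H * ('X - 'X^(N.+1))
  = ('X * P^`() + P * C) + 'X^(N.+1) * (H - C - N.+1%:R).
  by rewrite exprS -mulr_natr; ring.
by rewrite dvdp_add // dvdp_mulr.
Qed.

Lemma newton_coef N H c n : newton N H c -> (n < N)%N ->
  H`_n *+ n + \sum_(i < n) c i.+1 * H`_(n - i.+1) = 0.
Proof.
case/dvdpP => Q E nN.
have Z := congr1 (fun p : {poly algC} => p`_n) E; rewrite /= coefMXn nN in Z.
rewrite -[RHS]Z coefD coefXM coef_deriv; congr (_ + _); first by case: n {nN Z}.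
(* Terms of the series beyond degree [n] do not reach the coefficient of ['X^n]. *)
rewrite /newton_series mulr_sumr coef_sum (big_cat_nat (n := n.+1)) //=.
rewrite [X in _ = _ + X]big_nat_cond [X in _ = _ + X]big1 ?addr0; last first.
  by move=> k /andP[/andP[nk _] _]; rewrite -scalerAr coefZ coefMXn nk mulr0.
rewrite big_add1 /= big_mkord; apply: eq_bigr => i _.
by rewrite -scalerAr coefZ coefMXn ltnNge ltn_ord.
Qed.

(** ** Cyclotomic factorisations of semigroup polynomials *)

Section Semigroup.
Variables (S : set nat) (s : seq nat).
Hypothesis numS : numerical_semigroup S.
Hypothesis s_gt0 : all (fun n => 0 < n)%N s.
Hypothesis Ps : semigroup_poly S = \prod_(n <- s) 'Phi_n.

Definition gap_poly : {poly int} := \sum_(g \in ~` S) ('X^g : {poly int}).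

Lemma coef_gap_poly n : gap_poly`_n = (n \notin S)%:R.
Proof.
have [sG GE] : exists sG : seq nat, uniq sG /\ ~` S = [set` sG].
  have [_ /finite_seqP[sG ->]] := numS; exists (undup sG); split; first exact: undup_uniq.
  by apply/seteqP; split=> x /=; rewrite mem_undup.
case: GE => uG GE; rewrite /gap_poly GE -fsbig_seq // coef_sum.
have -> : (n \notin S) = (n \in sG).
  apply/idP/idP => [|nG]; first by rewrite notin_setE => nS; have : (~` S) n by []; rewrite GE.
  by rewrite notin_setE; suff : (~` S) n by []; rewrite GE.
under eq_bigr do rewrite coefXn.
have [nG|nG] := boolP (n \in sG).
rewrite (bigD1_seq n) //= eqxx big1 ?addr0 // => i /negPf.
  by rewrite eq_sym => ->.
rewrite big1_seq // => i /= iG; case: eqP => // ni; by rewrite ni iG in nG.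
Qed.

Lemma semigroup_newton n :
  (n * (n \in S))%N%:Z
  + \sum_(i < n) (\sum_(m <- s) ram m i.+1 - 1) * ((n - i.+1)%N \in S)%:R = 0.
Proof.
pose P : {poly algC} := map_poly intr (semigroup_poly S).
pose G : {poly algC} := map_poly intr gap_poly.
(* The all-ones series up to degree [n], less the gaps: up to that degree the coefficients of [H]
   are the indicator function of [S]. *)
pose H : {poly algC} := \sum_(i < n.+1) 'X^i - G.
have HP : (1 - 'X) * H = P - 'X^(n.+1).
  have PG : P = 1 + ('X - 1) * G.
    by rewrite /P /semigroup_poly -/gap_poly rmorphD rmorphM rmorphB /= map_polyX rmorph1.
  have := subrX1 ('X : {poly algC}) n.+1; rewrite PG /H => XE.
  have -> : 'X^(n.+1) = 1 + ('X - 1) * \sum_(i < n.+1) 'X^i :> {poly algC}.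
    by rewrite -XE; ring.
  by ring.
have NP : newton n.+1 P (fun k => \sum_(m <- s) (ram m k)%:~R).
  rewrite /P Ps rmorph_prod /=; apply: newton_prod => m ms; apply: newton_Cyclotomic.
  exact: (allP s_gt0).
have NH := newton_geometric_quotient _ _ _ _ HP NP.
have Hi i : (i <= n)%N -> H`_i = (i \in S)%:R.
  move=> le_in; rewrite /H coefB /G coef_map coef_gap_poly coef_sum.
  under eq_bigr do rewrite coefXn.
  rewrite (bigD1 (inord i)) //= inordK ?ltnS // eqxx big1 ?addr0.
    by case: (i \in S); rewrite ?subr0 ?subrr.
  move=> j ji; case: eqP => // ij; case/eqP: ji; apply: val_inj.
  by rewrite /= inordK ?ltnS.
apply: (@intr_inj algC); rewrite -[RHS](newton_coef _ _ _ _ NH (ltnSn n)).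
rewrite rmorphD /= rmorph_sum /=; congr (_ + _).
  by rewrite Hi // -[LHS]/((n * _)%:R) natrM mulr_natl.
apply: eq_bigr => i _; rewrite rmorphM rmorphB /= rmorph_sum /= Hi ?leq_subr //.
by rewrite rmorph_nat.
Qed.

(** Strong induction: in the identity at a gap [n], a term with [k < n] a gap vanishes by induction,
    and one with [k] in [S] has [n - k] a gap. Only the term [k = n] is left. *)
Lemma ram_sum_gap n : (0 < n)%N -> ~ S n -> \sum_(m <- s) ram m n = 1.
Proof.
have [[S0 SD] _] := numS.
elim/ltn_ind: n => -[//|n] IH _ nS.
have := semigroup_newton n.+1; rewrite (memNset nS) muln0 add0r big_ord_recr /=.
rewrite subnn (mem_set S0) mulr1 big1 ?add0r; first by move/eqP; rewrite subr_eq0 => /eqP.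
move=> i _; have [iS|iS] := pselect (S i.+1); last first.
  by rewrite IH // ?subrr ?mul0r // ltnS.
have le_in : (i.+1 <= n.+1)%N by exact: leqW.
rewrite memNset ?mulr0 // => kS; apply: nS; rewrite -(subnKC le_in); exact: SD.
Qed.

(** At the least [n] in [S] outside [M], a term of the identity with [n - k] in [S] has [n - k] in
    [M], so [k] is outside [M] and its coefficient is 0. This would leave [n = 0]. *)
Lemma semigroup_sub (M : set nat) : submonoid M ->
  (forall n, (0 < n)%N -> ~ M n -> \sum_(m <- s) ram m n = 1) -> S `<=` M.
Proof.
move=> [M0 MD] Mr n; elim/ltn_ind: n => -[//|n] IH nS; apply: contrapT => nM.
have := semigroup_newton n.+1; rewrite (mem_set nS) muln1 big1 ?addr0 // => i _.
have [kS|kS] := pselect (S (n.+1 - i.+1)%N); last by rewrite (memNset kS) mulr0.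
rewrite Mr ?subrr ?mul0r // => iM; apply: nM; rewrite -(subnKC (ltn_ord i)).
by apply: MD => //; apply: IH => //; rewrite ltn_subrL.
Qed.

(** A gap at 1 makes the gap polynomial nonzero; its leading exponent is then a gap, one less than
    the degree of the semigroup polynomial. *)
Lemma semigroup_poly_gap : ~ S 1%N -> ~ S (\sum_(m <- s) totient m).-1.
Proof.
move=> S1; rewrite /= -notin_setE.
have G0 : gap_poly != 0.
  apply: contra_not_neq S1 => G0; have := coef_gap_poly 1; rewrite G0 coef0.
  by case: (boolP (1%N \in S)) => // /set_mem.
have sz : size (semigroup_poly S) = (size gap_poly).+1.
  have sG : size (('X - 1) * gap_poly) = (size gap_poly).+1.
    by rewrite mulrC size_Mmonic ?monicXsubC // size_XsubC addn2.
  by rewrite /semigroup_poly -/gap_poly addrC size_polyDl sG // size_poly1 ltnS size_poly_gt0.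
have szP : size (semigroup_poly S) = (\sum_(m <- s) totient m).+1.
  rewrite Ps; elim: (s) => [|m r IH]; first by rewrite !big_nil size_poly1.
  have mr : \prod_(j <- r) 'Phi_j \is monic by apply: monic_prod => j _; apply: Cyclotomic_monic.
  rewrite !big_cons size_Mmonic ?monic_neq0 ?Cyclotomic_monic //.
  by rewrite size_Cyclotomic IH addnS.
have := lead_coef_eq0 gap_poly; rewrite (negPf G0) lead_coefE.
move: sz; rewrite szP => -[<-]; rewrite coef_gap_poly.
by case: (_ \notin S).
Qed.

(** At 1 the semigroup polynomial has value 1 and ['Phi_1] has value 0. The index 1 must be told
    apart because [ram 1 1] is 1 as well. *)
Lemma one_notin_cyclotomic_factors : 1%N \notin s.
Proof.
apply/negP => s1; have := congr1 (fun p : {poly int} => p.[1]) Ps.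
rewrite /semigroup_poly !hornerE (big_rem _ s1) /= hornerM.
have := @prod_Cyclotomic 1 isT; rewrite (_ : divisors 1 = [:: 1%N]) // big_seq1 => ->.
by rewrite !hornerE ?mul0r => /eqP; rewrite oner_eq0.
Qed.

Lemma semigroup_poly_trivial : S 1%N -> semigroup_poly S = 1.
Proof.
have [[S0 SD] _] := numS => S1.
have -> : S = setT.
  by apply/seteqP; split => // n _; elim: n => // n IH; rewrite -addn1; apply: SD.
by rewrite /semigroup_poly setCT fsbig_set0 mulr0 addr0.
Qed.

End Semigroup.

(** ** Counting irreducible factors *)

(** Over the rationals ['Phi_m] is the minimal polynomial of a primitive root [z]. In a
    factorisation [r q], a root [z] of [r] would give [r] full degree and make [q] constant; so [z]
    is a root of [q]. *)
Lemma irreducible_Cyclotomic m : (0 < m)%N -> irreducible_poly (poly_int_to_rat 'Phi_m).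
Proof.
move=> m0; have zP := prim_rootE m m0; set z := prim_root m in zP.
have [p [pE pm] pdvd] := minCpolyP z.
have -> : poly_int_to_rat 'Phi_m = p.
  apply: (@map_poly_inj _ _ (@ratr algC)); rewrite -pE (minCpoly_cyclotomic zP).
  rewrite -(Cintr_Cyclotomic zP) /poly_int_to_rat -map_poly_comp.
  by apply: eq_map_poly => i /=; rewrite ratr_int.
have p0 := monic_neq0 pm.
split=> [|q q1 /dvdpP[r pqr]].
  have := size_minCpoly z; rewrite pE; rewrite size_map_poly //.
have rq0 : (r != 0) && (q != 0) by rewrite -negb_or -mulf_eq0 -pqr.
case/andP: rq0 => r0 q0.
have : root (map_poly (@ratr algC) p) z by rewrite pdvd.
rewrite pqr rmorphM rootM !pdvd => /orP[pr|pq]; last first.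
  by rewrite -pqr /eqp pq pqr dvdp_mull.
have := dvdp_leq r0 pr; rewrite pqr size_mul //.
move: q1 q0 r0; rewrite -!size_poly_gt0 => q1 q0 r0 sz.
have aux (a b : nat) : (a != 1 -> 0 < a -> 0 < b -> (b + a).-1 <= b -> False)%N by lia.
by case: (aux _ _ q1 q0 r0 sz).
Qed.

Lemma irreducible_dvd_prod (F : fieldType) (I : eqType) (r : seq I) (g : I -> {poly F}) f :
  irreducible_poly f -> f %| \prod_(i <- r) g i -> exists2 i, i \in r & f %| g i.
Proof.
move=> irf; elim: r => [|i r IH].
  rewrite big_nil dvdp1 => /eqP f1; by have := irf.1; rewrite f1.
rewrite big_cons; have [fi _|fi] := boolP (f %| g i); first by exists i; rewrite ?mem_head.
have cop : coprimep f (g i).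
  by rewrite qpoly.irreducible_poly_coprime.
rewrite Gauss_dvdpr // => /IH[j jr fj]; exists j => //; by rewrite inE jr orbT.
Qed.

(** The first factor is already associated with [f], so the others multiply to a unit and there are
    none. *)
Lemma irreducible_eqp_prod (F : fieldType) (I : eqType) (r : seq I) (g : I -> {poly F}) f :
  (forall i, i \in r -> 1 < size (g i))%N -> irreducible_poly f ->
  f %= \prod_(i <- r) g i -> exists i, r = [:: i].
Proof.
case: r => [|i r] gr irf.
  by rewrite big_nil -size_poly_eq1 => /eqP f1; have := irf.1; rewrite f1.
rewrite big_cons => fE; have gi := gr i (mem_head i r).
have : g i %= f.
  apply: irf; first by rewrite gtn_eqF.
  by rewrite (eqp_dvdr _ fE) dvdp_mulr.
move=> /eqp_trans/(_ fE); rewrite -{1}[g i]mulr1 eqp_mul2l -?size_poly_gt0 ?(ltnW gi) //.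
rewrite eqp_sym -size_poly_eq1.
case: r gr {fE} => [|j r] gr; first by exists i.
rewrite big_cons => /eqP s1.
have gj : (1 < size (g j))%N by apply: gr; rewrite !inE eqxx orbT.
have P0 : g j * \prod_(j <- r) g j != 0 by rewrite -size_poly_gt0 s1.
have := dvdp_leq P0 (dvdp_mulr (\prod_(j <- r) g j) (dvdpp (g j))).
by rewrite s1 leqNgt gj.
Qed.

(** One factor is associated with [f1]; cancelling it leaves a product associated with the
    irreducible [f2], hence a single factor. *)
Lemma irreducible_mul_eq_prod (F : fieldType) (I : eqType) (r : seq I) (g : I -> {poly F}) f1 f2 :
  (forall i, i \in r -> irreducible_poly (g i)) ->
  irreducible_poly f1 -> irreducible_poly f2 ->
  \prod_(i <- r) g i = f1 * f2 -> size r = 2.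
Proof.
move=> gr ir1 ir2 E.
have [|i ir fi] := irreducible_dvd_prod _ _ r g f1 ir1; first by rewrite E dvdp_mulr.
have fgi : f1 %= g i by apply: (gr i ir) => //; rewrite gtn_eqF // ir1.1.
have [j rE] : exists j, rem i r = [:: j].
  apply: (irreducible_eqp_prod _ _ _ g f2) => //.
    by move=> j /mem_rem jr; case: (gr j jr).
  rewrite -(eqp_mul2l f2 _ (irredp_neq0 ir1)) -E (big_rem _ ir) /=.
  by apply: eqp_mulr; rewrite eqp_sym.
by have := size_rem ir; rewrite rE; case: (r) ir => //= a [|b [|]].
Qed.

(** ** Gaps of submonoids *)

(** Symmetry of [<u, v>]: if [n] is not in it, then [F - n] is, with [F = u v - u - v]. The second
    equation avoids truncated subtraction. *)
Lemma sylvester u v n : (0 < u)%N -> (0 < v)%N -> coprime u v ->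
  (exists a b, n = a * u + b * v)%N \/ (exists a b, n + (a * u + b * v) + u + v = u * v)%N.
Proof.
move=> u0 v0 cuv; have [x y xy _] := egcdnP v u0; rewrite (eqP cuv) in xy.
(* The least [a] with [a u] congruent to [n] modulo [v]; the two cases are [a u <= n] and
   [a u > n]. *)
pose a := ((n * x) %% v)%N.
have av : (a < v)%N by rewrite ltn_mod.
have aE : a * u = n %[mod v].
  by rewrite /a modnMml -mulnA xy mulnDr muln1 mulnA modnMDl.
have [le|lt] := leqP (a * u) n.
  left; have : (v %| n - a * u)%N by rewrite -(eqn_mod_dvd v le); apply/eqP.
  by case/dvdnP => b bE; exists a, b; rewrite -bE subnKC.
right; have : (v %| a * u - n)%N by rewrite -(eqn_mod_dvd v (ltnW lt)); apply/eqP.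
case/dvdnP => -[|c] cE; first by lia.
case: v {cuv aE lt xy a} (a) v0 av cE => // v a _ av cE; exists (v - a)%N, c.
have H : ((v - a) * u + a * u = v * u)%N by rewrite -mulnDl subnK.
lia.
Qed.

Section Submonoids.
Variable S : set nat.
Hypothesis subS : submonoid S.

Lemma submonoid_mull a n : S n -> S (a * n)%N.
Proof.
have [S0 SD] := subS => nS; elim: a => // a IH; rewrite mulSn; exact: SD.
Qed.

Lemma submonoid_lin a b u v : S u -> S v -> S (a * u + b * v)%N.
Proof. by case: subS => _ SD uS vS; apply: SD; apply: submonoid_mull. Qed.

Lemma gap_bound u v g : (0 < u)%N -> (0 < v)%N -> coprime u v -> S u -> S v -> ~ S g ->
  (g + u + v <= u * v)%N.
Proof.
move=> u0 v0 cuv uS vS gS; have [[a [b gE]]|[a [b gE]]] := sylvester u v g u0 v0 cuv.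
  by case: gS; rewrite gE; apply: submonoid_lin.
by rewrite -gE; lia.
Qed.

(* The Frobenius number of [<p, q u, q v>] is at most [q F + (q - 1) p], where
   [F = u v - u - v] is that of [<u, v>]. *)
Lemma gap_bound3 p q u v g : (0 < p)%N -> (0 < q)%N -> (0 < u)%N -> (0 < v)%N ->
  coprime p q -> coprime u v -> S p -> S (q * u)%N -> S (q * v)%N -> ~ S g ->
  (g + p + q * u + q * v <= q * u * v + q * p)%N.
Proof.
move=> p0 q0 u0 v0 cpq cuv pS uS vS gS.
have [[a [b gE]]|[a [b gE]]] := sylvester p q g p0 q0 cpq; last first.
  have H : (q * (u + v) <= q * (u * v + 1))%N.
    by rewrite leq_mul2l; apply/orP; right; case: (u) u0 => // x _; case: (v) v0 => // y _; lia.
  lia.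
have aE := divn_eq a q; have aq : (a %% q < q)%N by rewrite ltn_mod.
set a1 := (a %/ q)%N in aE; set a0 := (a %% q)%N in aE aq.
(* Multiples of [q] in the coefficient of [p] are moved over: [g = a0 p + q b1] with [a0 < q], so
   [b1] in [<u, v>] would put [g] in [S]. *)
pose b1 := (b + a1 * p)%N.
have {}gE : g = (a0 * p + q * b1)%N by rewrite /b1 gE aE; lia.
have [[c [d bE]]|[c [d bE]]] := sylvester u v b1 u0 v0 cuv; last first.
  have H1 : (q * (b1 + u + v) <= q * (u * v))%N by rewrite leq_mul2l -bE; lia.
  have H2 : (a0.+1 * p <= q * p)%N by rewrite leq_mul2r aq orbT.
  rewrite gE; lia.
case: gS; have [_ SD] := subS; rewrite gE bE; apply: SD; first exact: submonoid_mull.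
by rewrite mulnDr !(mulnCA q); apply: submonoid_lin.
Qed.

End Submonoids.

Lemma generated_submonoidP G : submonoid (generated_submonoid G).
Proof.
split; first by move=> M [[M0 _] _].
by move=> m n Gm Gn M MG; have [[_ MD] _] := MG; apply: MD; [apply: Gm|apply: Gn].
Qed.

Lemma generated_submonoid_gen G n : G n -> generated_submonoid G n.
Proof. by move=> Gn M [_]; apply. Qed.

Lemma generated_submonoid_min G S : submonoid S -> G `<=` S -> generated_submonoid G `<=` S.
Proof. by move=> subS GS n; apply. Qed.

Lemma generated_submonoid_dvd G d n : G d -> (d %| n)%N -> generated_submonoid G n.
Proof.
move=> Gd /dvdnP[k ->]; apply: (submonoid_mull (generated_submonoid G)).
  exact: generated_submonoidP.
exact: generated_submonoid_gen.
Qed.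

(** A totient of at most 1 leaves the indices 1 and 2, and [ram 2 1 = -1]. *)
Lemma ram_eq1_totient_le1 n : (0 < n)%N -> ram n 1 = 1 -> (totient n <= 1)%N -> n = 1%N.
Proof.
move=> n0 r1; rewrite leqNgt totient_gt1 -leqNgt => n2.
have [n2'|] := eqVneq n 2%N; last by lia.
by move: r1; rewrite n2' ram_prime.
Qed.

(** The number of prime factors is even and not 0; removing two of them restores the sign. *)
Lemma ram_even_split n : (0 < n)%N -> n != 1%N -> ram n 1 = 1 ->
  exists p q m, [/\ prime p /\ prime q, n = (p * (q * m))%N, coprime p (q * m), coprime q m
    & (0 < m)%N /\ ram m 1 = 1].
Proof.
move=> n0 n1 rn; have [p pp pn] : {p | prime p & (p %| n)%N} by apply: pdivP; lia.
have [|m [nE cpm m0 rm]] := ram_squarefree n p n0 pp pn; first by rewrite rn.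
have m1 : m != 1%N by apply/eqP => mE; move: rm; rewrite mE ram1 rn.
have [q pq qm] : {p | prime p & (p %| m)%N} by apply: pdivP; lia.
have [|l [mE cql l0 rl]] := ram_squarefree m q m0 pq qm; first by rewrite rm rn.
exists p, q, l; split; rewrite -?mE //; split => //.
by rewrite rl rm rn opprK.
Qed.

(** ** One and two factors *)

Lemma ram_primeM p m k : prime p -> (0 < m)%N -> coprime p m ->
  ram (p * m) k = ((p * (p %| k))%N%:Z - 1) * ram m k.
Proof. by move=> pp m0 cpm; rewrite ram_coprime ?(prime_gt0 pp) // ram_prime. Qed.

Lemma ram_primeX2M p m k : prime p -> (0 < m)%N -> coprime p m ->
  ram (p ^ 2 * m) k = ((p ^ 2 * (p ^ 2 %| k))%N%:Z - (p * (p %| k))%N%:Z) * ram m k.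
Proof.
move=> pp m0 cpm; rewrite ram_coprime ?expn_gt0 ?(prime_gt0 pp) ?coprimeXl //.
by rewrite ram_prime_power // expn1.
Qed.

Lemma coprime_primes p q : prime p -> prime q -> p != q -> coprime p q.
Proof. by move=> pp pq npq; rewrite prime_coprime // dvdn_prime2. Qed.

Lemma cyclotomic_semigroup_one (S : set nat) n :
  submonoid S -> (0 < n)%N -> n != 1%N -> ram n 1 = 1 ->
  (forall k, (0 < k)%N -> ~ S k -> ram n k = 1) ->
  ~ S (totient n).-1 ->
  (forall M, submonoid M -> (forall k, (0 < k)%N -> ~ M k -> ram n k = 1) -> S `<=` M) ->
  exists p q, [/\ prime p, prime q, p != q, S = generated_submonoid [set p; q] & n = (p * q)%N].
Proof.
move=> subS n0 n1 rn Sgap Sdeg Smin.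
have [p [q [m [[pp pq] nE cpqm cqm [m0 rm]]]]] := ram_even_split n n0 n1 rn.
have p1 := prime_gt1 pp; have q1 := prime_gt1 pq.
have [cpq cpm] : coprime p q /\ coprime p m by move: cpqm; rewrite coprimeMr => /andP.
have cqp : coprime q p by rewrite coprime_sym.
have qm0 : (0 < q * m)%N by rewrite muln_gt0 m0 prime_gt0.
have rE k : ram n k = ((p * (p %| k))%N%:Z - 1) * (((q * (q %| k))%N%:Z - 1) * ram m k).
  by rewrite nE !ram_primeM.
have npq : (q %| p)%N = false by apply/negbTE; rewrite -prime_coprime // coprime_sym.
have nqp : (p %| q)%N = false by apply/negbTE; rewrite -prime_coprime.
have pS : S p.
  (* At a gap [p] the Ramanujan sum would be [1 - p] instead of 1. *)
  apply: contrapT => nS; have := Sgap p (prime_gt0 pp) nS.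
  by rewrite rE dvdnn npq (ram_at_coprime m p) // rm; lia.
have qS : S q.
  apply: contrapT => nS; have := Sgap q (prime_gt0 pq) nS.
  by rewrite rE dvdnn nqp (ram_at_coprime m q) // rm; lia.
have := gap_bound S subS p q _ (prime_gt0 pp) (prime_gt0 pq) cpq pS qS Sdeg.
rewrite nE !totient_coprime // (totient_prime pp) (totient_prime pq) => bd.
(* The gap [(p-1)(q-1) totient m - 1] is at most [(p-1)(q-1) - 1], the Frobenius number of
   [<p, q>]. *)
have m1 : m = 1%N.
  apply: ram_eq1_totient_le1 => //.
  have : (0 < totient m)%N by rewrite totient_gt0.
  case: p pp p1 {pS nqp npq cpqm cpq cpm cqp nE rE} bd => // p _ p1.
  by case: q pq q1 {qS qm0 cqm} => // q _ q1 /=; nia.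
exists p, q; split => //; last by rewrite m1 muln1.
  by apply: contraFneq npq => ->; rewrite dvdnn.
apply/seteqP; split; last by apply: generated_submonoid_min => // x [->|->].
apply: Smin; first exact: generated_submonoidP.
move=> k k0 kM.
have -> : ram n k = ((p * (p %| k))%N%:Z - 1) * (((q * (q %| k))%N%:Z - 1)).
  by rewrite rE m1 ram1 mulr1.
have [pk|_] := boolP (p %| k)%N.
  by case: kM; apply: generated_submonoid_dvd pk; left.
have [qk|_] := boolP (q %| k)%N.
  by case: kM; apply: generated_submonoid_dvd qk; right.
by rewrite !muln0.
Qed.

Lemma muln_le1 m n : (0 < m)%N -> (0 < n)%N -> (m * n <= 1)%N -> m = 1%N.
Proof. by move=> m0 n0 mn; apply/eqP; rewrite eqn_leq m0 (leq_trans _ mn) ?leq_pmulr. Qed.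

(** The bound of [gap_bound3] for a second index [q^2 r u n] with [t = totient n]. Cancelling the
    terms in [p] and dividing by [q] turns it into [(q-1) t (r-1)(u-1) <= (r-1)(u-1)]. *)
Lemma four_primes_degree p q r u t : (0 < p)%N -> (1 < q)%N -> (1 < r)%N -> (1 < u)%N ->
  ((p.-1 * q.-1 + q.-1 * q * (r.-1 * (u.-1 * t))).-1 + p + q * r + q * u
    <= q * r * u + q * p)%N -> (q.-1 * t <= 1)%N.
Proof.
case: p => // x _; case: q => // y y0; case: r => // z z0; case: u => // w w0 /=.
apply: contraTT; rewrite -!ltnNge => yt.
have H := leq_mul (leqnn (y.+1 * (z * w))) yt.
have : (0 < y.+1 * (z * w))%N by rewrite !muln_gt0; apply/andP; split; last by apply/andP.
lia.
Qed.

(** The inequality amounts to [(p-1)(q-1) t + u <= (p-1)(q-1)]. *)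
Lemma two_primes_degree p q t u : (0 < p)%N -> (0 < q)%N -> (0 < t)%N -> (0 < u)%N ->
  ((p.-1 * (q.-1 * t) + u).-1 + p + q <= p * q)%N -> False.
Proof.
case: p => // x _; case: q => // y _ t0 u0 /=.
have := leq_mul (leqnn (x * y)) t0; lia.
Qed.

(** Multiply the hypothesis by [q] and substitute; the coefficient [q + q.-1] is [2q - 1]. *)
Lemma largest_gap_decomposition p q r x y : (0 < p)%N -> (0 < q)%N -> (0 < r)%N ->
  (p + (x * q + y * r) + q + r = q * r)%N ->
  ((p.-1 * q.-1 + q.-1 * q * r.-1).-1 = (q + q.-1) * p + (x * q ^ 2 + y * (q * r)))%N.
Proof.
case: p => // a _; case: q => // b _; case: r => // c _ /= E.
have := congr1 (muln b.+1) E; rewrite -mulnn; lia.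
Qed.

(** * Two factors with indices [p q] and [q^2 b'], where [p] lies in the semigroup *)

Section TwoFactors.
Variables (S : set nat) (p q b' : nat).
Hypothesis subS : submonoid S.
Hypotheses (pp : prime p) (pq : prime q) (npq : p != q).
Hypotheses (pS : S p) (b'0 : (0 < b')%N) (cqb : coprime q b') (rb' : ram b' 1 = -1).
Hypothesis Sgap : forall k, (0 < k)%N -> ~ S k -> ram (p * q) k + ram (q ^ 2 * b') k = 1.
Hypothesis Sdeg : ~ S (totient (p * q) + totient (q ^ 2 * b')).-1.
Hypothesis Smin : forall M, submonoid M ->
  (forall k, (0 < k)%N -> ~ M k -> ram (p * q) k + ram (q ^ 2 * b') k = 1) -> S `<=` M.

Let p1 : (1 < p)%N. Proof. exact: prime_gt1. Qed.
Let q1 : (1 < q)%N. Proof. exact: prime_gt1. Qed.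
Let p0 : (0 < p)%N. Proof. exact: prime_gt0. Qed.
Let q0 : (0 < q)%N. Proof. exact: prime_gt0. Qed.
Let cpq : coprime p q. Proof. exact: coprime_primes. Qed.
Let cqp : coprime q p. Proof. by rewrite coprime_sym. Qed.

Let rpq k : ram (p * q) k = ((p * (p %| k))%N%:Z - 1) * ((q * (q %| k))%N%:Z - 1).
Proof. by rewrite ram_primeM // ram_prime. Qed.

Let not_dvd_q2 : (p %| q ^ 2)%N = false.
Proof. by rewrite Euclid_dvdX // dvdn_prime2 // (negPf npq). Qed.

(** At a gap [q^2] the two Ramanujan sums would add up to [1 - q^2] instead of 1. *)
Lemma core_q2 : S (q ^ 2)%N.
Proof.
apply: contrapT => nS; have q20 : (0 < q ^ 2)%N by rewrite expn_gt0 q0.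
have := Sgap _ q20 nS; rewrite rpq ram_primeX2M // not_dvd_q2 dvdnn dvdn_mulr //.
rewrite (ram_at_coprime b' (q ^ 2)) ?coprimeXl // rb'.
move: q1 (leq_mul q1 q1); rewrite -mulnn; clear; lia.
Qed.

Lemma totient_core : (totient (p * q) + totient (q ^ 2 * b') =
  p.-1 * q.-1 + q.-1 * q * totient b')%N.
Proof.
have cq2b : coprime (q ^ 2) b' by rewrite coprimeXl.
rewrite (totient_coprime cpq) (totient_coprime cq2b).
by rewrite (totient_prime pp) (totient_prime pq) totient_pfactor.
Qed.

Lemma core_dvd : (p %| b')%N -> b' = p /\ S = generated_submonoid [set p; (q ^ 2)%N].
Proof.
move=> pb; have [|c [bE cpc c0 rc]] := ram_squarefree b' p b'0 pp pb; first by rewrite rb'.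
(* The degree is [(p-1)(q-1)(1 + q t)] with [t = totient c], and the bound from [p] and [q^2] is
   [(p-1)(q-1)(1 + q)]. *)
have c1 : c = 1%N.
  apply: ram_eq1_totient_le1 => //; first by rewrite rc rb' opprK.
  have cpq2 : coprime p (q ^ 2) by rewrite coprimeXr.
  have q20 : (0 < q ^ 2)%N by rewrite expn_gt0 q0.
  have := gap_bound S subS p (q ^ 2)%N _ p0 q20 cpq2 pS core_q2 Sdeg.
  rewrite totient_core bE (totient_coprime cpc) (totient_prime pp).
  apply: contraTT; rewrite -!ltnNge; move: (totient c) => t t2.
  case: (p) p1 => // x x0; case: (q) q1 => // y y0 /=.
  have H : (y * y.+1 * x * 2 <= y * y.+1 * x * t)%N by rewrite leq_mul2l t2 orbT.
  have xy0 : (0 < x * y)%N by rewrite muln_gt0; apply/andP.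
  have := leq0n (x * y * y); rewrite -!mulnn; lia.
have bp : b' = p by rewrite bE c1 muln1.
split => //; apply/seteqP; split; last first.
  by apply: generated_submonoid_min => // x [->|->] //; apply: core_q2.
apply: Smin; first exact: generated_submonoidP.
move=> k k0 kM; rewrite rpq ram_primeX2M // bp ram_prime //.
have [pk|_] := boolP (p %| k)%N.
  by case: kM; apply: generated_submonoid_dvd pk; left.
have [qk|_] := boolP (q ^ 2 %| k)%N.
  by case: kM; apply: generated_submonoid_dvd qk; right.
(* What remains is [1 - q [q | k]] from the index [p q] and [q [q | k]] from [q^2 p]. *)
rewrite !muln0; ring.
Qed.

(** At a gap [q r] the sums would be [1 - q] and [- q (r - 1)], with total [1 - q r] instead of
    1. *)
Lemma core_qr r : ~~ (p %| b')%N -> prime r -> (r %| b')%N -> S (q * r)%N.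
Proof.
move=> npb pr rb; have [|c [bE crc c0 rc]] := ram_squarefree b' r b'0 pr rb; first by rewrite rb'.
have [cqr cqc] : coprime q r /\ coprime q c by move: cqb; rewrite bE coprimeMr => /andP.
have npr : p != r by apply: contraNneq npb => ->.
have nqr : (q == r) = false.
  by apply: contraTF cqr => /eqP ->; rewrite /coprime gcdnn gtn_eqF // prime_gt1.
have e1 : (p %| q * r)%N = false.
  by rewrite Euclid_dvdM // (dvdn_prime2 pp pq) (dvdn_prime2 pp pr) (negPf npq) (negPf npr).
have e2 : (q ^ 2 %| q * r)%N = false.
  by rewrite -mulnn dvdn_pmul2l // (dvdn_prime2 pq pr).
apply: contrapT => nS; have qr0 : (0 < q * r)%N by rewrite muln_gt0 q0 prime_gt0.
have := Sgap _ qr0 nS; rewrite rpq ram_primeX2M // bE ram_primeM //.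
rewrite (ram_at_coprime c (q * r)) ?coprimeMl ?cqc // rc rb'.
rewrite e1 e2 dvdn_mulr // dvdn_mull // !muln0 !muln1.
move: q1 (leq_mul (leqnn q) (prime_gt1 pr)); clear; lia.
Qed.

Lemma core_ndvd : ~~ (p %| b')%N -> exists r, [/\ prime r, p != r, q != r, b' = r &
  generated_submonoid [set q; r] p /\
  S = generated_submonoid [set p; (q ^ 2)%N; (q * r)%N]].
Proof.
move=> npb; have b'1 : b' != 1%N by apply/eqP => bE; move: rb'; rewrite bE ram1.
have [r pr rb] : {p | prime p & (p %| b')%N} by apply: pdivP; lia.
have [|c [bE crc c0 rc]] := ram_squarefree b' r b'0 pr rb; first by rewrite rb'.
have [cqr cqc] : coprime q r /\ coprime q c by move: cqb; rewrite bE coprimeMr => /andP.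
have r0 := prime_gt0 pr.
have npr : p != r by apply: contraNneq npb => ->.
have nqr : q != r by apply: contraTneq cqr => ->; rewrite prime_coprime // dvdnn.
have qrS := core_qr r npb pr rb.
(* Otherwise [c] contains two further primes [u], [v]; with [p], [q r] and [q u] in [S], the bound
   of [gap_bound3] leaves only [q = v = 2], but [q] is prime to [c]. *)
have c1 : c = 1%N.
  apply/eqP; apply: contraT => c1.
  have [|u [v [d [[pu pv] cE cuvd cvd [d0 _]]]]] := ram_even_split c c0 c1.
    by rewrite rc rb' opprK.
  have ub : (u %| b')%N by rewrite bE cE; apply: dvdn_mull; apply: dvdn_mulr.
  have quS := core_qr u npb pu ub.
  have cru : coprime r u by move: crc; rewrite cE coprimeMr => /andP[].
  have := gap_bound3 S subS p q r u _ p0 q0 r0 (prime_gt0 pu) cpq cru pS qrS quS Sdeg.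
  have crud : coprime r (u * (v * d)) by rewrite -cE.
  rewrite totient_core bE cE (totient_coprime crud) (totient_coprime cuvd).
  rewrite (totient_prime pr) (totient_prime pu).
  have t0 : (0 < totient (v * d))%N by rewrite totient_gt0 muln_gt0 (prime_gt0 pv).
  move=> /(four_primes_degree _ _ _ _ _ p0 q1 (prime_gt1 pr) (prime_gt1 pu)) yt.
  have q2 : q.-1 = 1%N by apply: (muln_le1 _ (totient (v * d))) => //; rewrite -ltnS prednK.
  have : (totient (v * d) <= 1)%N by move: yt; rewrite q2 mul1n.
  rewrite leqNgt totient_gt1 -leqNgt => vd2; have v2 : v = 2%N.
    by apply/eqP; rewrite eqn_leq prime_gt1 // (leq_trans _ vd2) // leq_pmulr.
  have {}q2 : q = 2%N by rewrite -(prednK q0) q2.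
  by move: cqc; rewrite cE q2 v2 /coprime gcdnC mulnCA gcdnC gcdnMr.
have bEr : b' = r by rewrite bE c1 muln1.
exists r; split => //; split; last first.
  apply/seteqP; split; last first.
    by apply: generated_submonoid_min => // x [[->|->]|->] //; apply: core_q2.
  apply: Smin; first exact: generated_submonoidP.
  move=> k k0 kM; rewrite rpq ram_primeX2M // bEr ram_prime //.
  have [pk|_] := boolP (p %| k)%N.
    by case: kM; apply: generated_submonoid_dvd pk; left; left.
  have [qk|_] := boolP (q ^ 2 %| k)%N.
    by case: kM; apply: generated_submonoid_dvd qk; left; right.
  (* The sums are 1 and 0 if [q] does not divide [k], and [1 - q] and [q] if [q] does but [r] does
     not; otherwise [q r] divides [k]. *)
  have [qk|_] := boolP (q %| k)%N; last by rewrite !muln0; ring.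
  have [rk|_] := boolP (r %| k)%N; last by rewrite !muln0 !muln1; ring.
  case: kM; apply: (generated_submonoid_dvd _ (q * r)%N); first by right.
  by rewrite Gauss_dvd ?qk.
have [[x [y ->]]|[x [y E]]] := sylvester q r p q0 r0 cqr.
  apply: (submonoid_lin (generated_submonoid [set q; r])).
  - exact: generated_submonoidP.
  - by apply: generated_submonoid_gen; left.
  - by apply: generated_submonoid_gen; right.
(* If [p] is not in [<q, r>], this semigroup, being symmetric, contains [F - p], where [F] is its
   Frobenius number; the gap [deg P_S - 1] equals [(2q - 1) p + q (F - p)], an element of [S]. *)
case: Sdeg; rewrite totient_core bEr (totient_prime pr).
have -> : ((p.-1 * q.-1 + q.-1 * q * r.-1).-1 =
  (q + q.-1) * p + (x * q ^ 2 + y * (q * r)))%N.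
  exact: largest_gap_decomposition.
have [_ SD] := subS; apply: SD; first exact: submonoid_mull.
by apply: submonoid_lin => //; apply: core_q2.
Qed.
End TwoFactors.

(** The value -1 makes [b'] a product of an odd number of distinct primes. *)
Definition ramified (b p : nat) : Prop :=
  exists b', [/\ b = (p ^ 2 * b')%N, coprime p b', (0 < b')%N & ram b' 1 = -1].

(** The cofactor of [p^2] in [b] is squarefree, so it cannot contain [q^2] for another prime [q]. *)
Lemma ramified_inj b p q : prime p -> prime q -> ramified b p -> ramified b q -> p = q.
Proof.
move=> pp pq [c [bE cpc c0 rc]] [d [bE' cqd d0 rd]].
have [//|npq] := eqVneq p q.
have cqp : coprime q p by rewrite coprime_sym coprime_primes.
have q2c : (q ^ 2 %| c)%N.
  rewrite -(@Gauss_dvdr _ (p ^ 2)) ?coprimeXl ?coprimeXr // -bE bE'.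
  exact: dvdn_mulr.
have qc : (q %| c)%N by apply: dvdn_trans q2c; rewrite expnS dvdn_mulr.
have [|e [cE cqe _ _]] := ram_squarefree c q c0 pq qc; first by rewrite rc.
move: q2c; rewrite cE expnS expn1 dvdn_pmul2l ?prime_gt0 //.
by move=> qe; move: cqe; rewrite prime_coprime // qe.
Qed.

Lemma cyclotomic_semigroup_two (S : set nat) a b :
  submonoid S -> (0 < a)%N -> (0 < b)%N -> a != 1%N -> ram a 1 = 1 -> ram b 1 = 0 ->
  (forall k, (0 < k)%N -> ~ S k -> ram a k + ram b k = 1) ->
  ~ S (totient a + totient b).-1 ->
  (forall M, submonoid M ->
     (forall k, (0 < k)%N -> ~ M k -> ram a k + ram b k = 1) -> S `<=` M) ->
  (exists p q, [/\ prime p /\ prime q, p != q,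
      S = generated_submonoid [set p; (q ^ 2)%N], a = (p * q)%N & b = (p * q ^ 2)%N]) \/
  (exists p q r, [/\ [/\ prime p, prime q & prime r], [/\ p != q, p != r & q != r],
      generated_submonoid [set q; r] p,
      S = generated_submonoid [set p; (q ^ 2)%N; (q * r)%N] & a = (p * q)%N /\ b = (q ^ 2 * r)%N]).
Proof.
move=> subS a0 b0 a1 ra rb Sgap Sdeg Smin; set goal := (_ \/ _).
(* At a gap [p] dividing [a] the first sum is [1 - p], so the second has to be [p]. *)
have ramS p : prime p -> (p %| a)%N -> ~ S p -> ramified b p.
  move=> pp pa nS; apply: ram_ramified => //.
  have [|c [aE cpc c0 rc]] := ram_squarefree a p a0 pp pa; first by rewrite ra.
  have := Sgap p (prime_gt0 pp) nS; rewrite aE ram_primeM // dvdnn (ram_at_coprime c p) // rc ra.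
  by lia.
(* The Frobenius number of [<p, q>] is too small for the degree, to which [b] contributes as
   well. *)
have notboth p q m : prime p -> prime q -> a = (p * (q * m))%N -> coprime p q ->
    coprime p (q * m) -> coprime q m -> (0 < m)%N -> S p -> S q -> False.
  move=> pp pq aE cpq cpqm cqm m0 pS qS.
  have := gap_bound S subS p q _ (prime_gt0 pp) (prime_gt0 pq) cpq pS qS Sdeg.
  rewrite aE (totient_coprime cpqm) (totient_coprime cqm) (totient_prime pp) (totient_prime pq).
  have : (0 < totient b)%N by rewrite totient_gt0.
  have : (0 < totient m)%N by rewrite totient_gt0.
  exact: (two_primes_degree _ _ _ _ (prime_gt0 pp) (prime_gt0 pq)).
have core p q : prime p -> prime q -> p != q -> a = (p * q)%N -> S p -> ramified b q -> goal.
  move=> pp pq npq aE pS [c [bE cqc c0 rc]]; rewrite aE bE in Sgap Sdeg Smin.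
  have [pc|pc] := boolP (p %| c)%N.
    have [cE SE] := core_dvd S p q c subS pp pq npq pS c0 cqc rc Sgap Sdeg Smin pc.
    by left; exists p, q; split => //; rewrite bE cE mulnC.
  have [r [pr npr nqr cE [pgen SE]]] :=
    core_ndvd S p q c subS pp pq npq pS c0 cqc rc Sgap Sdeg Smin pc.
  by right; exists p, q, r; split => //; rewrite bE cE.
have [p [q [m [[pp pq] aE cpqm cqm [m0 rm]]]]] := ram_even_split a a0 a1 ra.
have [cpq cpm] : coprime p q /\ coprime p m by move: cpqm; rewrite coprimeMr => /andP.
have npq : p != q by apply: contraTneq cpq => ->; rewrite prime_coprime // dvdnn.
have pa : (p %| a)%N by rewrite aE dvdn_mulr.
have qa : (q %| a)%N by rewrite aE mulnCA dvdn_mulr.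
(* Given a third prime [r] of [a], at most one of [p], [q], [r] lies in [S]; two are then gaps and
   both ramified in [b], against [ramified_inj]. *)
have m1 : m = 1%N.
  apply/eqP; apply: contraT => m1.
  have [r [t [d [[pr _] mE crtd _ [d0 _]]]]] := ram_even_split m m0 m1 rm.
  set n := (t * d)%N in mE crtd; clearbody n.
  have [cpr cpn] : coprime p r /\ coprime p n by move: cpm; rewrite mE coprimeMr => /andP.
  have [cqr cqn] : coprime q r /\ coprime q n by move: cqm; rewrite mE coprimeMr => /andP.
  have n0 : (0 < n)%N by case: (n) mE => // mE; rewrite mE muln0 in m0.
  have ra' : (r %| a)%N by rewrite aE mE; do 2 apply: dvdn_mull; apply: dvdn_mulr.
  have crp : coprime r p by rewrite coprime_sym.
  have crq : coprime r q by rewrite coprime_sym.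
  have cqp : coprime q p by rewrite coprime_sym.
  have npr : p != r by apply: contraTneq cpr => ->; rewrite prime_coprime // dvdnn.
  have nqr : q != r by apply: contraTneq cqr => ->; rewrite prime_coprime // dvdnn.
  have nb_pq : S p -> S q -> False.
    exact: (notboth p q m pp pq aE cpq cpqm cqm m0).
  have nb_pr : S p -> S r -> False.
    apply: (notboth p r (q * n)%N) => //; last by rewrite muln_gt0 prime_gt0.
    - by rewrite aE mE; congr muln; rewrite mulnCA.
    - by rewrite !coprimeMr cpr cpq cpn.
    - by rewrite coprimeMr crq crtd.
  have nb_qr : S q -> S r -> False.
    apply: (notboth q r (p * n)%N) => //; last by rewrite muln_gt0 prime_gt0.
    - by rewrite aE mE mulnCA; congr muln; rewrite mulnCA.
    - by rewrite !coprimeMr cqr cqp cqn.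
    - by rewrite coprimeMr crp crtd.
  have inj_pq := ramified_inj b p q pp pq; have inj_pr := ramified_inj b p r pp pr.
  have inj_qr := ramified_inj b q r pq pr.
  exfalso; have [pS|pS] := pselect (S p); have [qS|qS] := pselect (S q);
    have [rS|rS] := pselect (S r); try by auto.
  - by case/eqP: nqr; apply: inj_qr; apply: ramS.
  - by case/eqP: npr; apply: inj_pr; apply: ramS.
  - by case/eqP: npq; apply: inj_pq; apply: ramS.
  - by case/eqP: npq; apply: inj_pq; apply: ramS.
have {}aE : a = (p * q)%N by rewrite aE m1 muln1.
(* Exactly one of [p] and [q] lies in [S]; it takes the first place in [core]. *)
have [pS|pS] := pselect (S p).
  apply: (core p q) => //; apply: ramS => // qS.
  by apply: (notboth p q 1%N); rewrite ?muln1 ?coprimen1.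
apply: (core q p) => //; [by rewrite eq_sym|by rewrite mulnC| |exact: ramS].
apply: contrapT => qS; case/eqP: npq.
by apply: (ramified_inj b) => //; apply: ramS.
Qed.

(** * From the cyclotomic factorisation to the theorem *)

Lemma semigroup_poly_cyclotomic_factors S s : numerical_semigroup S ->
  all (fun n => 0 < n)%N s -> semigroup_poly S = \prod_(n <- s) 'Phi_n ->
  (0 < size s)%N -> ~ S 1%N.
Proof.
move=> numS s0 Ps; apply: contraTnot => S1; rewrite -leqNgt.
(* With 1 in [S] the polynomial is 1, whereas a single factor already has degree [totient m > 0]. *)
have := Ps; rewrite (semigroup_poly_trivial S numS S1).
case: s s0 Ps => [|m s] //= /andP[m0 s0] _; rewrite big_cons => E.
have mr : \prod_(j <- s) 'Phi_j \is monic by apply: monic_prod => j _; apply: Cyclotomic_monic.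
have := size_Mmonic (monic_neq0 (Cyclotomic_monic m)) mr; rewrite -E size_poly1 size_Cyclotomic.
have := monic_neq0 mr; rewrite -size_poly_gt0.
have : (0 < totient m)%N by rewrite totient_gt0.
lia.
Qed.

Theorem theorem1p2 (S : set nat) (hS : cyclotomic_semigroup S) :
  (irreducible_poly (poly_int_to_rat (semigroup_poly S)) ->
     exists p q : nat,
       [/\ prime p, prime q, p != q,
           S = generated_submonoid [set p; q] &
           semigroup_poly S = 'Phi_(p * q)])
  /\
  ((exists f g : {poly rat},
      [/\ irreducible_poly f, irreducible_poly g &
          poly_int_to_rat (semigroup_poly S) = f * g]) ->
     (exists p q : nat,
        [/\ prime p, prime q, p != q,
            S = generated_submonoid [set p; (q ^ 2)%N] &
            semigroup_poly S = 'Phi_(p * q) * 'Phi_(p * q ^ 2)])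
     \/
     (exists p q r : nat,
        [/\ [/\ prime p, prime q & prime r],
            [/\ p != q, p != r & q != r],
            generated_submonoid [set q; r] p,
            S = generated_submonoid [set p; (q ^ 2)%N; (q * r)%N] &
            semigroup_poly S = 'Phi_(p * q) * 'Phi_(q ^ 2 * r)])).
Proof.
have [numS [s s0 Ps]] := hS; have [subS _] := numS.
have PsQ : poly_int_to_rat (semigroup_poly S) = \prod_(m <- s) poly_int_to_rat 'Phi_m.
  by rewrite Ps /poly_int_to_rat rmorph_prod.
have Sgap := ram_sum_gap S s numS s0 Ps.
have Smin := semigroup_sub S s numS s0 Ps.
have Sdeg := semigroup_poly_gap S s numS Ps.
have s1 := one_notin_cyclotomic_factors S s Ps.
have S1 : (0 < size s)%N -> ~ S 1%N by exact: semigroup_poly_cyclotomic_factors.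
have irr m : m \in s -> irreducible_poly (poly_int_to_rat 'Phi_m).
  by move=> /(allP s0); apply: irreducible_Cyclotomic.
split=> [irP|[f [g [irf irg fg]]]].
  have [m sE] : exists m, s = [:: m].
    apply: (irreducible_eqp_prod _ _ _ (fun m => poly_int_to_rat 'Phi_m) _ _ irP).
      by move=> i /irr[].
    by rewrite PsQ eqpxx.
  rewrite sE /= inE eq_sym andbT in s0 s1 S1.
  have {}Sgap k : (0 < k)%N -> ~ S k -> ram m k = 1 by have := Sgap k; rewrite sE big_seq1.
  have {}Sdeg : ~ S (totient m).-1 by have := Sdeg (S1 isT); rewrite sE big_seq1.
  have [M subM Mgap|p [q [pp pq npq SE mE]]] :=
      cyclotomic_semigroup_one S m subS s0 s1 (Sgap 1%N isT (S1 isT)) Sgap Sdeg.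
    by apply: Smin => // k k0 /(Mgap k k0); rewrite sE big_seq1.
  by exists p, q; split; rewrite // Ps sE big_seq1 mE.
set goal := (_ \/ _).
have : size s = 2.
  apply: (irreducible_mul_eq_prod _ _ _ (fun m => poly_int_to_rat 'Phi_m) f g) => //.
  by rewrite -PsQ.
(* The order of the two indices in [s] is not known; [a] is the one of Moebius value 1. *)
have main a b : ram a 1 = 1 -> ram b 1 = 0 -> perm_eq s [:: a; b] -> goal.
  move=> ra rb sE.
  have bigE (R : nmodType) (F : nat -> R) : \sum_(m <- s) F m = F a + F b.
    by rewrite (perm_big _ sE) big_cons big_seq1.
  have PE : semigroup_poly S = 'Phi_a * 'Phi_b by rewrite Ps (perm_big _ sE) big_cons big_seq1.
  have a0 : (0 < a)%N by apply: (allP s0); rewrite (perm_mem sE) mem_head.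
  have b0 : (0 < b)%N by apply: (allP s0); rewrite (perm_mem sE) !inE eqxx orbT.
  have a1 : a != 1%N by apply: contraNneq s1 => <-; rewrite (perm_mem sE) mem_head.
  rewrite (perm_size sE) in S1.
  have {}Sgap k : (0 < k)%N -> ~ S k -> ram a k + ram b k = 1 by have := Sgap k; rewrite bigE.
  have {}Sdeg : ~ S (totient a + totient b).-1.
    by have := Sdeg (S1 isT); rewrite (perm_big _ sE) big_cons big_seq1.
  have [M subM Mgap|[p [q [[pp pq] npq SE aE bE]]]|
      [p [q [r [[pp pq pr] [npq npr nqr] pgen SE [aE bE]]]]]] :=
      cyclotomic_semigroup_two S a b subS a0 b0 a1 ra rb Sgap Sdeg.
  - by apply: Smin => // k k0 /(Mgap k k0); rewrite bigE.
  - by left; exists p, q; split; rewrite // PE aE bE.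
  - by right; exists p, q, r; split; rewrite // PE aE bE.
case: s s0 s1 S1 Sgap {Ps PsQ Smin Sdeg irr} main => [|a [|b []]] //= /and3P[a0 b0 _].
move=> _ S1 Sgap main _; have := Sgap 1%N isT (S1 isT); rewrite !big_cons big_nil addr0.
(* Two values among -1, 0 and 1 with sum 1 are 1 and 0, in either order. *)
have [] := ram_at1_range a a0; have [] := ram_at1_range b b0 => rb ra; rewrite ra rb // => _.
- by apply: (main b a) => //; rewrite (perm_catC [:: a] [:: b]).
- by apply: (main a b).
Qed.
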